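(* Let $\Sigma: x^+=Ax+Bu+Ew$ be a discrete-time linear system with $A$ nilpotent of nilpotency index $\nu$, and let the safe set $S_{xu}\subset\mathbb{R}^n\times\mathbb{R}^m$ and the disturbance set $W\subset\mathbb{R}^d$ be polytopes. Then $\mathcal{C}_{outer,\nu}$ is nonempty if and only if there exist $q\in\mathbb{N}$ and matrices $P\in\mathbb{R}^{mq\times mq}$, $H\in\mathbb{R}^{m\times mq}$ such that the corresponding implicit RCIS $\mathcal{C}_{xv}$ is nonempty. Specifically, $\mathcal{C}_{outer,\nu}\neq\emptyset$ if and only if $\mathcal{C}_{xv,(0,1)}\neq\emptyset$, where $\mathcal{C}_{xv,(0,1)}$ is the implicit RCIS corresponding to the $(\tau,\lambda)$-lasso matrices with $(\tau,\lambda)=(0,1)$, i.e. $q=1$ and $P=H=I_m$.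
   Context: Setting: $x\in\mathbb{R}^n$, $u\in\mathbb{R}^m$, $w\in W$; $A\in\mathbb{R}^{n\times n}$, $B\in\mathbb{R}^{n\times m}$, $E\in\mathbb{R}^{n\times d}$. $\nu$ is the smallest positive integer with $A^\nu=0$. A polytope is a bounded set of the form $\{z\mid Gz\le f\}$. Sums of sets are Minkowski sums; $Q-P=\{z\mid z+p\in Q\ \forall p\in P\}$. $\overline{W}_t=\sum_{i=1}^tA^{i-1}EW$ (with $\overline{W}_0=\{0\}$) and $\overline{W}_\infty=\sum_{i=1}^{\nu}A^{i-1}EW$. Reachable set: $\mathcal{R}_\Sigma(x,\{u_i\}_{i=0}^{t-1})=A^tx+\sum_{i=1}^tA^{i-1}Bu_{t-i}+\overline{W}_t$, with $\mathcal{R}_\Sigma(x,\emptyset)=\{x\}$. For a set $R\subseteq\mathbb{R}^n$ and $u\in\mathbb{R}^m$, $(R,u)$ denotes $R\times\{u\}$. RPIS: for a system $z^+=Fz+Gw$, $w\in W$, a set $\mathcal{C}\subseteq S$ is a robust positively invariant set (RPIS) within $S$ if $z\in\mathcal{C}$ implies $Fz+Gw\in\mathcal{C}$ for all $w\in W$; the Maximal RPIS contains every RPIS within $S$. Implicit RCIS corresponding to $P,H$: the set $\mathcal{C}_{xv}$ that is the Maximal RPIS of the companion system $\Sigma_{xv}$: $x^+=Ax+BHv+Ew$, $v^+=Pv$, $w\in W$, $(x,v)\in\mathbb{R}^n\times\mathbb{R}^{mq}$, within the companion safe set $S_{xv}=\{(x,v)\mid(x,Hv)\in S_{xu}\}$.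 Its projection onto the first $n$ coordinates is a robust controlled invariant set of $\Sigma$ within $S_{xu}$. For $P=H=I_m$ it equals the set of $(x,u)\in\mathbb{R}^n\times\mathbb{R}^m$ such that the constant input sequence $u_t=u$ satisfies $(\mathcal{R}_\Sigma(x,\{u_i\}_{i=0}^{t-1}),u_t)\subseteq S_{xu}$ for all $t\ge0$. Nominal system and safe set: $\overline{\Sigma}: x^+=Ax+Bu$ and $\overline{S}_{xu}=S_{xu}-\overline{W}_\infty\times\{0\}$. A controlled invariant set (CIS) of $\overline{\Sigma}$ within $\overline{S}_{xu}$ is a set $\mathcal{C}$ such that for every $x\in\mathcal{C}$ there is $u$ with $(x,u)\in\overline{S}_{xu}$ and $Ax+Bu\in\mathcal{C}$; $\overline{\mathcal{C}}_{\max}$ is the maximal (largest) such set. Define $$\mathcal{C}_{outer,\nu}=\Big\{x\in\mathbb{R}^n\ \Big|\ \exists\{u_i\}_{i=0}^{\nu-1}\in\mathbb{R}^{m\nu}:\ (\mathcal{R}_\Sigma(x,\{u_i\}_{i=0}^{t-1}),u_t)\subseteq S_{xu},\ t=0,\dots,\nu-1,\ \ \mathcal{R}_\Sigma(x,\{u_i\}_{i=0}^{\nu-1})\subseteq\overline{\mathcal{C}}_{\max}+\overline{W}_\infty\Big\}.$$ *)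

(* Defs.v *)
From HB Require Import structures.
From mathcomp Require Import all_boot all_order all_algebra.
From mathcomp Require Import all_classical all_reals all_analysis.

Set Implicit Arguments.
Unset Strict Implicit.
Unset Printing Implicit Defensive.

Import Order.TTheory GRing.Theory Num.Theory.
Import numFieldNormedType.Exports.

Local Open Scope classical_set_scope.
Local Open Scope ring_scope.

(* Vectors of R^k are column vectors 'cV[R]_k, and R^n x R^m is identified
   with R^(n+m) = 'cV[R]_(n + m): the pair (x, u) is col_mx x u. *)

Section Sets.
Variable R : realType.

(* The norm of 'cV[R]_k is the sup norm.  The empty set is a polytope. *)
Definition polytope k (S : set 'cV[R]_k) : Prop :=
  (exists (p : nat) (G : 'M[R]_(p, k)) (f : 'cV[R]_p),
      S = [set z | forall i, (G *m z) i 0 <= f i 0])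
  /\ bounded_set S.

Definition minkowski_sum k (P Q : set 'cV[R]_k) : set 'cV[R]_k :=
  [set p + q | p in P & q in Q].

Definition pontryagin_diff k (Q P : set 'cV[R]_k) : set 'cV[R]_k :=
  [set z | forall p, P p -> Q (z + p)].

Definition product_set n m (X : set 'cV[R]_n) (U : set 'cV[R]_m) :
    set 'cV[R]_(n + m) :=
  [set col_mx x u | x in X & u in U].

Definition nilpotency_index n (A : 'M[R]_n) (nu : nat) : Prop :=
  [/\ (0 < nu)%N, A ^+ nu = 0 &
      forall k, (0 < k)%N -> A ^+ k = 0 -> (nu <= k)%N].

End Sets.

Section Invariance.
Variable R : realType.

(* Robust positive invariance for z^+ = F z + G w, w in W. *)
Definition RPIS k d (F : 'M[R]_k) (G : 'M[R]_(k, d)) (W : set 'cV[R]_d)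
    (S C : set 'cV[R]_k) : Prop :=
  C `<=` S /\ forall z, C z -> forall w, W w -> C (F *m z + G *m w).

Definition max_RPIS k d (F : 'M[R]_k) (G : 'M[R]_(k, d)) (W : set 'cV[R]_d)
    (S : set 'cV[R]_k) : set 'cV[R]_k :=
  \bigcup_(C in [set C | RPIS F G W S C]) C.

Lemma max_RPISP k d (F : 'M[R]_k) (G : 'M[R]_(k, d)) (W : set 'cV[R]_d)
    (S : set 'cV[R]_k) :
  RPIS F G W S (max_RPIS F G W S) /\
  forall C, RPIS F G W S C -> C `<=` max_RPIS F G W S.
Proof.
split=> [|C hC z Cz]; last by exists C.
split=> [z [C [CS _] Cz]|z [C [CS hC] Cz] w Ww]; first exact: CS.
by exists C; [split|exact: hC].
Qed.

(* Controlled invariance for x^+ = A x + B u within S. *)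
Definition CIS n m (A : 'M[R]_n) (B : 'M[R]_(n, m)) (S : set 'cV[R]_(n + m))
    (C : set 'cV[R]_n) : Prop :=
  forall x, C x -> exists u : 'cV[R]_m, S (col_mx x u) /\ C (A *m x + B *m u).

Definition max_CIS n m (A : 'M[R]_n) (B : 'M[R]_(n, m))
    (S : set 'cV[R]_(n + m)) : set 'cV[R]_n :=
  \bigcup_(C in [set C | CIS A B S C]) C.

Lemma max_CISP n m (A : 'M[R]_n) (B : 'M[R]_(n, m)) (S : set 'cV[R]_(n + m)) :
  CIS A B S (max_CIS A B S) /\ forall C, CIS A B S C -> C `<=` max_CIS A B S.
Proof.
split=> [x [C hC Cx]|C hC x Cx]; last by exists C.
by have [u [Su Cu]] := hC x Cx; exists u; split=> //; exists C.
Qed.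

End Invariance.

Section LinearSystem.
Variables (R : realType) (n m d : nat).
Variables (A : 'M[R]_n) (B : 'M[R]_(n, m)) (E : 'M[R]_(n, d)).
Variables (Sxu : set 'cV[R]_(n + m)) (W : set 'cV[R]_d).

(* Indices are shifted by one: i < t stands for i - 1 with 1 <= i <= t. *)
Definition disturbance_sum (t : nat) : set 'cV[R]_n :=
  \big[@minkowski_sum R n/[set 0]]_(i < t) [set A ^+ i *m E *m w | w in W].

(* Reachable set under the input sequence us of length t = size us; in
   particular it is [set x] for us = [::]. *)
Definition reach (x : 'cV[R]_n) (us : seq 'cV[R]_m) : set 'cV[R]_n :=
  let t := size us in
  minkowski_sum
    [set A ^+ t *m x + \sum_(i < t) A ^+ i *m B *m us`_(t - i.+1)]
    (disturbance_sum t).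

(* W_infinity is disturbance_sum nu, where nu is the nilpotency index of A. *)
Definition nominal_safe (nu : nat) : set 'cV[R]_(n + m) :=
  pontryagin_diff Sxu (product_set (disturbance_sum nu) [set 0]).

Definition C_outer (nu : nat) : set 'cV[R]_n :=
  [set x | exists us : nu.-tuple 'cV[R]_m,
     (forall t, (t < nu)%N ->
        product_set (reach x (take t us)) [set us`_t] `<=` Sxu) /\
     reach x us `<=` minkowski_sum (max_CIS A B (nominal_safe nu))
                                   (disturbance_sum nu)].

(* The companion system has state (x, v) in R^n x R^k and dynamics
   x^+ = A x + B H v + E w, v^+ = P v. *)
Definition companion_safe k (H : 'M[R]_(m, k)) : set 'cV[R]_(n + k) :=
  [set z | Sxu (col_mx (usubmx z) (H *m dsubmx z))].

Definition implicit_RCIS k (P : 'M[R]_k) (H : 'M[R]_(m, k)) :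
    set 'cV[R]_(n + k) :=
  max_RPIS (block_mx A (B *m H) 0 P) (col_mx E 0) W (companion_safe H).

End LinearSystem.

(* Main.v *)
Require Import Defs.
From mathcomp Require Import all_boot all_order all_algebra.
From mathcomp Require Import all_classical all_reals all_analysis.
Import Order.TTheory GRing.Theory Num.Theory.
Import numFieldNormedType.Exports.
Local Open Scope classical_set_scope.
Local Open Scope ring_scope.

Set Implicit Arguments.
Unset Strict Implicit.
Unset Printing Implicit Defensive.

(** Nilpotency makes the disturbance sets stabilise after nu steps: every
    disturbance_sum t with t >= nu equals W_infinity, and A W_infinity + E W is
    contained in W_infinity.  The disturbed states reachable at time t are the
    nominal state plus disturbance_sum t, so from time nu on the uncertainty
    around the nominal state is the fixed set W_infinity.

    An implicit invariant set, for any P and H, therefore gives a point of the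
    outer bound: feeding the inputs u_t = H P^t v keeps all disturbed states
    safe, so the nominal states from time nu on form a controlled invariant set
    of the nominal system within the tightened safe set
    (implicit_RCIS_C_outer).

    Conversely, a point of the outer bound yields a point of the maximal
    nominal controlled invariant set, hence an infinite nominal trajectory
    (x_t, u_t) in the tightened safe set, which is convex, closed and bounded.
    The Cesaro averages of (x_t, u_t) stay in that set, and
    A x + B u - x evaluated at the average over T steps telescopes to
    (x_T - x_0) / T, which tends to 0.  Any limit point (xb, ub) of the averages
    is thus an equilibrium in the tightened safe set
    (trajectory_equilibrium), and (xb + W_infinity) x {ub} is robustly
    invariant under the constant input ub (C_outer_implicit_RCIS).

    If W is empty there is no nominal trajectory to extract, but then every
    subset of the companion safe set is robustly invariant, and both the outer
    bound and the set for P = H = I are nonempty exactly when the safe set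
    is. *)

(** * Nominal trajectories *)

Fixpoint trajectory (R : realType) n m (A : 'M[R]_n) (B : 'M[R]_(n, m))
    (x : 'cV[R]_n) (u : nat -> 'cV[R]_m) (t : nat) : 'cV[R]_n :=
  if t is s.+1 then A *m trajectory A B x u s + B *m u s else x.

(** * Limit points of bounded vector sequences *)

Lemma entry_norm_le (R : realType) k (z : 'cV[R]_k) i : `|z i 0| <= `|z|.
Proof.
rewrite [leRHS]mx_normrE.
exact: (le_bigmax _ (fun ij : 'I_k * 'I_1 => `|z ij.1 ij.2|) (i, 0)).
Qed.

(** Compactness, in the form in which only linear functionals appear: an upper
    bound c t on l (z t), with c converging, passes to the limit point.  A
    constant c expresses closedness of half-spaces, and c tending to 0, used
    for l and - l, shows that l vanishes at the limit point. *)
Lemma bounded_seq_limit_point (R : realType) k (z : nat -> 'cV[R]_k) (M : R) :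
  (forall t, `|z t| <= M) ->
  exists zbar : 'cV[R]_k, forall (l : 'rV[R]_k) (c : nat -> R) (c0 : R),
    c @ \oo --> c0 -> (forall t, (l *m z t) 0 0 <= c t) ->
    (l *m zbar) 0 0 <= c0.
Proof.
move=> zM.
have Kco : compact [set v : 'rV[R]_k | forall i, `[- M, M]%classic (v ord0 i)].
  by apply: (@rV_compact R k (fun=> `[- M, M]%classic)) => i;
    exact: segment_compact.
have zK : \forall t \near \oo,
    [set v : 'rV[R]_k | forall i, `[- M, M]%classic (v ord0 i)] (z t)^T.
  near=> t => i; rewrite /= in_itv /= -ler_norml mxE.
  exact: le_trans (entry_norm_le _ _) (zM t).
have [zb [_ zbcl]] := Kco ((fun t => (z t)^T) @ \oo) _ zK.
exists zb^T => l c c0 cc0 lz; rewrite leNgt; apply/negP => c0l.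
pose f (v : 'rV[R]_k) := \sum_j l 0 j * v 0 j.
have fE v : f v = (l *m v^T) 0 0.
  by rewrite mxE; apply: eq_bigr => j _; rewrite mxE.
have fcont : continuous f.
  rewrite /f; elim: (index_enum _) => [|j s IHs].
    rewrite (_ : (fun _ : 'rV[R]_k => _) = fun=> 0).
      exact: cst_continuous.
    by apply/funext => v; rewrite big_nil.
  rewrite (_ : (fun _ : 'rV[R]_k => _) =
      (fun v : 'rV[R]_k => l 0 j * v 0 j + \sum_(i <- s) l 0 i * v 0 i));
    last first.
    by apply/funext => v; rewrite big_cons.
  move=> v; apply: (@continuousD _ R _ (fun v : 'rV[R]_k => l 0 j * v 0 j));
    last exact: IHs.
  apply: (@continuousM _ _ (fun=> l 0 j)); first exact: cst_continuous.
  exact: coord_continuous.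
rewrite -fE in c0l.
pose mid := (c0 + f zb) / 2.
have [c0mid midf] : c0 < mid /\ mid < f zb by rewrite !midf_lt.
have hc : \forall t \near \oo, c t < mid by exact: (cvgr_lt _ cc0).
have hf : \forall v \near zb, mid < f v by exact: (cvgr_gt _ (fcont zb)).
have hc' : ((fun t => (z t)^T) @ \oo) [set v | f v < mid].
  by apply: filterS hc => t; apply: le_lt_trans; rewrite fE trmxK.
have [v [/= v1 v2]] := zbcl _ _ hc' hf.
by have := lt_trans v1 v2; rewrite ltxx.
Unshelve. all: by end_near. Qed.

(** * Equilibria of the nominal system *)

(** Closed convex sets, presented as intersections of possibly infinitely many
    half-spaces l z <= c: the tightened safe set has one half-space for each
    inequality defining the safe set and each accumulated disturbance. *)
Definition halfspaces (R : realType) k (Q : set ('rV[R]_k * R)) :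
    set 'cV[R]_k :=
  [set z | forall lc, Q lc -> (lc.1 *m z) 0 0 <= lc.2].

(** A mean ergodic argument: averaging an infinite trajectory keeps it in the
    convex set, and the defect A x + B u - x of the average telescopes to the
    difference of two bounded states divided by the number of steps. *)
Lemma trajectory_equilibrium (R : realType) n m (A : 'M[R]_n)
    (B : 'M[R]_(n, m)) (Q : set ('rV[R]_(n + m) * R)) (M : R)
    (x : 'cV[R]_n) (u : nat -> 'cV[R]_m) :
  (forall z, halfspaces Q z -> `|z| <= M) ->
  (forall t, halfspaces Q (col_mx (trajectory A B x u t) (u t))) ->
  exists (xb : 'cV[R]_n) (ub : 'cV[R]_m),
    halfspaces Q (col_mx xb ub) /\ A *m xb + B *m ub = xb.
Proof.
move=> QM Qtraj; set X := trajectory A B x u in Qtraj.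
pose z t := col_mx (X t) (u t).
pose avg T : 'cV[R]_(n + m) := T.+1%:R^-1 *: \sum_(t < T.+1) z t.
have Tgt0 T : 0 < T.+1%:R :> R by rewrite ltr0n.
have avgQ T : halfspaces Q (avg T).
  move=> [l c] Qlc /=; rewrite -scalemxAr mulmx_sumr mxE summxE ler_pdivrMl //.
  rewrite mulr_natl -[X in _ *+ X]card_ord -sumr_const.
  by apply: ler_sum => t _; exact: (Qtraj t (l, c)).
(* D z is the displacement A x + B u - x of the state at z = (x, u). *)
pose D := row_mx (A - 1%:M) B.
have DavgE T : D *m avg T = T.+1%:R^-1 *: (X T.+1 - X 0%N).
  rewrite -scalemxAr mulmx_sumr; congr (_ *: _).
  rewrite -(big_mkord xpredT (fun t => D *m z t)) -(telescope_sumr X) //.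
  apply: eq_bigr => t _.
  by rewrite mul_row_col mulmxBl mul1mx /= addrAC.
have Davg_le T i : `|(D *m avg T) i 0| <= (M + M) * T.+1%:R^-1.
  have XM t j : `|X t j 0| <= M.
    have := entry_norm_le (z t) (lshift m j); rewrite col_mxEu => /le_trans.
    by apply; exact: QM (Qtraj t).
  rewrite DavgE mxE normrM gtr0_norm ?invr_gt0 // mulrC ler_pM2r ?invr_gt0 //.
  have -> : (X T.+1 - X 0%N) i 0 = X T.+1 i 0 - X 0%N i 0.
    by move: (X T.+1) (X 0%N) => a b; rewrite !mxE.
  by rewrite (le_trans (ler_normB _ _)) // lerD.
have [zb zbP] := bounded_seq_limit_point (fun T => QM _ (avgQ T)).
have rate0 : (fun T => (M + M) * T.+1%:R^-1) @ \oo --> (0 : R).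
  rewrite -[X in _ --> X](mulr0 (M + M)).
  by apply: cvgM; [exact: cvg_cst|exact: cvg_harmonic].
have Dzb : D *m zb = 0.
  apply/matrixP => i j; rewrite (ord1 j) [RHS]mxE; apply/eqP; rewrite eq_le.
  have rowE (v : 'cV[R]_(n + m)) : (row i D *m v) 0 0 = (D *m v) i 0.
    by rewrite -row_mul mxE.
  apply/andP; split.
    rewrite -rowE; apply: zbP rate0 _ => T; rewrite rowE.
    exact: le_trans (ler_norm _) (Davg_le T i).
  rewrite -oppr_le0 -rowE -[leLHS](_ : (- row i D *m zb) 0 0 = _); last first.
    by rewrite mulNmx mxE.
  apply: zbP rate0 _ => T; rewrite mulNmx mxE rowE.
  by apply: le_trans (Davg_le T i); rewrite -normrN ler_norm.
exists (usubmx zb), (dsubmx zb); split.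
  rewrite vsubmxK => -[l c] Qlc; apply: (zbP l (fun=> c)); first exact: cvg_cst.
  by move=> T; exact: (avgQ T (l, c)).
move: Dzb; rewrite -{1}(vsubmxK zb) mul_row_col mulmxBl mul1mx addrAC.
by move/eqP; rewrite subr_eq0 => /eqP.
Qed.

(** * Disturbance sums and reachable sets *)

Lemma minkowski_bigP (R : realType) k t (F : nat -> set 'cV[R]_k) y :
  (\big[@minkowski_sum R k/[set 0]]_(i < t) F i) y <->
  exists v : nat -> 'cV[R]_k,
    (forall i, (i < t)%N -> F i (v i)) /\ y = \sum_(i < t) v i.
Proof.
elim: t F y => [|t IHt] F y.
  rewrite big_ord0; split=> [->|[v [_ ->]]]; last by rewrite big_ord0.
  by exists (fun=> 0); rewrite big_ord0.
rewrite big_ord_recl; split=>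
  [[a Fa [b /(IHt (fun i => F i.+1))[v [Fv ->]] <-]]|[v [Fv ->]]].
  exists (fun i => if i is j.+1 then v j else a).
  split; last by rewrite big_ord_recl.
  by case=> [_|i it]; [exact: Fa|exact: Fv].
exists (v 0%N); first exact: Fv.
exists (\sum_(i < t) v i.+1); last by rewrite big_ord_recl.
apply/(IHt (fun i => F i.+1)); exists (fun i => v i.+1).
by split=> // i; exact: (Fv i.+1).
Qed.

Lemma expmx_vanish (R : realType) n (A : 'M[R]_n) nu t :
  A ^+ nu = 0 -> (nu <= t)%N -> A ^+ t = 0.
Proof. by move=> A0 /subnKC <-; rewrite exprD A0 mul0r. Qed.

Section DisturbedSystem.
Variables (R : realType) (n m d : nat).
Variables (A : 'M[R]_n) (B : 'M[R]_(n, m)) (E : 'M[R]_(n, d)).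
Variable W : set 'cV[R]_d.

Lemma disturbance_sumP t y :
  disturbance_sum A E W t y <->
  exists w : nat -> 'cV[R]_d,
    (forall i, (i < t)%N -> W (w i)) /\ y = \sum_(i < t) A ^+ i *m E *m w i.
Proof.
split=> [/(minkowski_bigP t (fun i => [set A ^+ i *m E *m w | w in W]))|].
  move=> [v [Fv ->]].
  have /choice[w wP] i : exists w, (i < t)%N -> W w /\ A ^+ i *m E *m w = v i.
    have [it|_] := boolP (i < t)%N; last by exists 0.
    by have [w Ww <-] := Fv i it; exists w.
  exists w; split=> [i /wP[]//|].
  by apply: eq_bigr => i _; have [_ ->] := wP i (ltn_ord i).
move=> [w [Ww ->]].
apply/(minkowski_bigP t (fun i => [set A ^+ i *m E *m w | w in W])).
by exists (fun i => A ^+ i *m E *m w i); split=> // i it; exists (w i) => //;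
  exact: Ww.
Qed.

(** The recursion W_(t+1) = A W_t + E W that drives every invariance argument
    below. *)
Lemma disturbance_sumS t y :
  disturbance_sum A E W t.+1 y <->
  exists y' w,
    [/\ disturbance_sum A E W t y', W w & y = A *m y' + E *m w].
Proof.
have shiftE (w : nat -> 'cV[R]_d) :
    \sum_(i < t.+1) A ^+ i *m E *m w i =
    A *m (\sum_(i < t) A ^+ i *m E *m w i.+1) + E *m w 0%N.
  rewrite big_ord_recl expr0 mul1mx addrC; congr (_ + _).
  rewrite mulmx_sumr; apply: eq_bigr => i _.
  by rewrite /= /bump /= add1n exprS -mulmxE !mulmxA.
split=>
  [/disturbance_sumP[w [Ww ->]]|[y' [w0 [/disturbance_sumP[w [Ww ->]] Ww0 ->]]]].
  exists (\sum_(i < t) A ^+ i *m E *m w i.+1), (w 0%N).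
  split=> //; last exact: Ww.
  apply/disturbance_sumP; exists (fun i => w i.+1).
  by split=> // i; exact: (Ww i.+1).
apply/disturbance_sumP; exists (fun i => if i is j.+1 then w j else w0).
split; first by case=> // i /Ww.
by rewrite (shiftE (fun i => if i is j.+1 then w j else w0)).
Qed.

(** The terms of index at least nu vanish.  Positivity of nu matters when W is
    empty: disturbance_sum 0 contains 0, whereas the later sums are empty. *)
Lemma disturbance_sum_stable nu t :
  (0 < nu)%N -> A ^+ nu = 0 -> (nu <= t)%N ->
  disturbance_sum A E W t = disturbance_sum A E W nu.
Proof.
move=> nu0 A0 nut.
have truncE (w : nat -> 'cV[R]_d) :
    \sum_(i < t) A ^+ i *m E *m w i = \sum_(i < nu) A ^+ i *m E *m w i.
  rewrite -(big_mkord xpredT (fun i => A ^+ i *m E *m w i)).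
  rewrite (big_cat_nat (n := nu)) //= big_mkord [X in _ + X]big_nat.
  rewrite [X in _ + X]big1 ?addr0 // => i /andP[nui _].
  by rewrite (expmx_vanish A0 nui) !mul0mx.
apply/seteqP; split=> y /disturbance_sumP[w [Ww ->]]; apply/disturbance_sumP.
  by exists w; split=> // i inu; apply: Ww; exact: leq_trans nut.
(* The indices from nu on need some element of W, and w 0 is one as 0 < nu. *)
exists (fun i => if (i < nu)%N then w i else w 0%N); split.
  by move=> i _; case: ifP => [/Ww//|_]; exact: Ww.
rewrite (truncE (fun i => if (i < nu)%N then w i else w 0%N)).
by apply: eq_bigr => i _; rewrite ltn_ord.
Qed.

Lemma trajectoryE x u t :
  trajectory A B x u t =
  A ^+ t *m x + \sum_(i < t) A ^+ i *m B *m u (t - i.+1)%N.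
Proof.
elim: t => [|t IHt]; first by rewrite big_ord0 addr0 expr0 mul1mx.
rewrite /= IHt mulmxDr mulmxA mulmxE -exprS -addrA; congr (_ + _).
rewrite big_ord_recl expr0 mul1mx subn1 /= addrC; congr (_ + _).
rewrite mulmx_sumr; apply: eq_bigr => i _.
by rewrite /bump /= add1n exprS subSS -!mulmxE !mulmxA.
Qed.

(** The input list is replaced by a function u that extends it, so that one
    trajectory serves reachable sets of all lengths. *)
Lemma reachP x (us : seq 'cV[R]_m) (u : nat -> 'cV[R]_m) y :
  (forall i, (i < size us)%N -> us`_i = u i) ->
  reach A B E W x us y <->
  exists2 w, disturbance_sum A E W (size us) w &
             y = trajectory A B x u (size us) + w.
Proof.
move=> usu.
suff trE : A ^+ size us *m x +
    \sum_(i < size us) A ^+ i *m B *m us`_(size us - i.+1) =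
    trajectory A B x u (size us).
  rewrite /reach /= trE.
  split=> [[a /= -> [w Ww <-]]|[w Ww ->]]; first by exists w.
  by exists (trajectory A B x u (size us)) => //; exists w.
rewrite trajectoryE; congr (_ + _); apply: eq_bigr => i _; rewrite usu //.
by rewrite ltn_subrL; case: (size us) i => [[]|].
Qed.

End DisturbedSystem.

(** * From an implicit invariant set to the outer bound *)

Section Companion.
Variables (R : realType) (n m d : nat).
Variables (A : 'M[R]_n) (B : 'M[R]_(n, m)) (E : 'M[R]_(n, d)).
Variables (Sxu : set 'cV[R]_(n + m)) (W : set 'cV[R]_d).

Lemma companion_step k (P : 'M[R]_k) (H : 'M[R]_(m, k))
    (x : 'cV[R]_n) (v : 'cV[R]_k) (w : 'cV[R]_d) :
  block_mx A (B *m H) 0 P *m col_mx x v + col_mx E 0 *m w =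
  col_mx (A *m x + B *m (H *m v) + E *m w) (P *m v).
Proof.
by rewrite mul_block_col mul_col_mx add_col_mx !mul0mx add0r addr0 -mulmxA.
Qed.

Lemma companion_safeE k (H : 'M[R]_(m, k)) (x : 'cV[R]_n) (v : 'cV[R]_k) :
  companion_safe Sxu H (col_mx x v) = Sxu (col_mx x (H *m v)).
Proof. by rewrite /companion_safe /= col_mxKu col_mxKd. Qed.

(** Since the implicit set is invariant under every disturbance, it contains
    the whole tube of disturbed states around the nominal trajectory. *)
Lemma implicit_RCIS_trajectory k (P : 'M[R]_k) (H : 'M[R]_(m, k))
    (x : 'cV[R]_n) (v : 'cV[R]_k) t (w : 'cV[R]_n) :
  implicit_RCIS A B E Sxu W P H (col_mx x v) ->
  disturbance_sum A E W t w ->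
  implicit_RCIS A B E Sxu W P H
    (col_mx (trajectory A B x (fun i => H *m (iter i (mulmx P) v)) t + w)
            (iter t (mulmx P) v)).
Proof.
have [[_ inv] _] := max_RPISP (block_mx A (B *m H) 0 P) (col_mx E 0) W
  (companion_safe Sxu H).
move=> xv; elim: t w => [|t IHt] w.
  by rewrite /disturbance_sum big_ord0 => ->; rewrite addr0.
move=> /disturbance_sumS[w' [e [/IHt Cw' We ->]]].
have := inv _ Cw' _ We.
by rewrite companion_step mulmxDr (addrAC _ (A *m w')) -(addrA _ (A *m w')).
Qed.

(** The nominal states at times t >= nu form a controlled invariant set: the
    tube around each of them has cross-section W_infinity, so safety of the
    tube is membership in the tightened safe set. *)
Lemma implicit_RCIS_C_outer nu k (P : 'M[R]_k) (H : 'M[R]_(m, k)) :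
  (0 < nu)%N -> A ^+ nu = 0 ->
  implicit_RCIS A B E Sxu W P H !=set0 -> C_outer A B E Sxu W nu !=set0.
Proof.
move=> nu0 A0 [z]; rewrite -(vsubmxK z); set x := usubmx z; set v := dsubmx z.
move=> Cxv; pose u i := H *m iter i (mulmx P) v; pose X := trajectory A B x u.
have safe t w : disturbance_sum A E W t w -> Sxu (col_mx (X t + w) (u t)).
  move=> /(implicit_RCIS_trajectory Cxv).
  have [[safe _] _] := max_RPISP (block_mx A (B *m H) 0 P) (col_mx E 0) W
    (companion_safe Sxu H).
  by move=> /safe; rewrite companion_safeE.
exists x; exists [tuple of mkseq u nu]; split=> [t tnu|y].
  have take_size : size (take t (mkseq u nu)) = t.
    by rewrite size_take size_mkseq tnu.
  have tlt i : (i < size (take t (mkseq u nu)))%N ->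
      (take t (mkseq u nu))`_i = u i.
    rewrite take_size => it.
    by rewrite nth_take // nth_mkseq // (ltn_trans it).
  move=> _ [y yreach [_ -> <-]].
  have [w] := iffLR (@reachP _ _ _ _ A B E W x _ u y tlt) yreach.
  rewrite take_size => Ww ->.
  by rewrite nth_mkseq //; exact: safe.
have mku i : (i < size (mkseq u nu))%N -> (mkseq u nu)`_i = u i.
  by rewrite size_mkseq => inu; rewrite nth_mkseq.
move=> /(@reachP _ _ _ _ A B E W x _ u _ mku)[w].
rewrite [size _]size_mkseq => Ww ->.
exists (X nu); last by exists w.
exists [set X t | t in [set t | (nu <= t)%N]]; last by exists nu => //=.
move=> _ [t /= nut <-]; exists (u t); split; last first.
  by exists t.+1 => //=; exact: leqW.
move=> _ [w' Ww' [_ -> <-]]; rewrite add_col_mx addr0; apply: safe.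
by rewrite (disturbance_sum_stable E W nu0 A0 nut).
Qed.

(** * From the outer bound to a constant input *)

Lemma max_CIS_trajectory (S : set 'cV[R]_(n + m)) (x : 'cV[R]_n) :
  max_CIS A B S x ->
  exists u : nat -> 'cV[R]_m, forall t, S (col_mx (trajectory A B x u t) (u t)).
Proof.
have [inv _] := max_CISP A B S; set C := max_CIS A B S in inv *.
move=> Cx.
have /choice[g gP] y : exists u : 'cV[R]_m,
    C y -> S (col_mx y u) /\ C (A *m y + B *m u).
  have [Cy|nCy] := pselect (C y); last by exists 0.
  by have [u uP] := inv y Cy; exists u.
pose X := fun t => iter t (fun y => A *m y + B *m g y) x.
have CX t : C (X t) by elim: t => [//|t IHt]; exact: (gP _ IHt).2.
exists (g \o X) => t.
have -> : trajectory A B x (g \o X) t = X t by elim: t => //= t ->.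
exact: (gP _ (CX t)).1.
Qed.

(** Tightening shifts each inequality defining the safe set by each accumulated
    disturbance. *)
Lemma nominal_safe_halfspaces nu p (G : 'M[R]_(p, n + m)) (f : 'cV[R]_p) :
  Sxu = [set z | forall i, (G *m z) i 0 <= f i 0] ->
  nominal_safe A E Sxu W nu =
  halfspaces [set lc | exists i w, disturbance_sum A E W nu w /\
    lc = (row i G, f i 0 - (G *m col_mx w 0) i 0)].
Proof.
have rowE i (v : 'cV[R]_(n + m)) : (row i G *m v) 0 0 = (G *m v) i 0.
  by rewrite -row_mul mxE.
move=> ->; apply/seteqP; split=> z.
  move=> zS _ [i [w [Ww ->]]] /=; rewrite rowE lerBrDr.
  have : product_set (disturbance_sum A E W nu) [set 0]
    (col_mx w (0 : 'cV[R]_m)).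
    by exists w => //; exists 0.
  by move=> /zS/(_ i); rewrite mulmxDr mxE.
move=> zH _ [w Ww [_ -> <-]] i; rewrite mulmxDr mxE -lerBrDr -rowE.
by apply: (zH (row i G, f i 0 - (G *m col_mx w 0) i 0)); exists i, w.
Qed.

(** The invariant set is the equilibrium of the nominal system thickened by
    W_infinity; it is safe because the equilibrium lies in the tightened safe
    set, and invariant because A W_infinity + E W lies in W_infinity. *)
Lemma C_outer_implicit_RCIS nu :
  (0 < nu)%N -> A ^+ nu = 0 -> polytope Sxu ->
  C_outer A B E Sxu W nu !=set0 ->
  implicit_RCIS A B E Sxu W (1%:M : 'M[R]_m) (1%:M : 'M[R]_m) !=set0.
Proof.
move=> nu0 A0 [[p [G [f SE]]] [M0 [_ SM]]] [x [us [xsafe xend]]].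
have [_ maxl] := max_RPISP (block_mx A (B *m 1%:M) 0 (1%:M : 'M[R]_m))
  (col_mx E 0) W (companion_safe Sxu 1%:M).
(* W_infinity is empty only if W is, and then the companion safe set is
   itself vacuously invariant. *)
have [[w0 Ww0]|noW] := pselect (disturbance_sum A E W nu !=set0); last first.
  have W0 w : ~ W w.
    move=> Ww; apply: noW; exists (\sum_(i < nu) A ^+ i *m E *m w).
    by apply/disturbance_sumP; exists (fun=> w).
  exists (col_mx x us`_0); apply: (maxl (companion_safe Sxu 1%:M)).
    by split=> // z _ w /W0.
  rewrite companion_safeE mul1mx; apply: (xsafe 0%N nu0); exists x; last first.
    by exists us`_0.
  rewrite take0; apply/(@reachP _ _ _ _ A B E W x [::] (fun=> 0)) => //.
  by exists 0; rewrite /= ?addr0 // /disturbance_sum big_ord0.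
have [|y Cy _] := xend (trajectory A B x (nth 0 us) nu + w0).
  apply/(@reachP _ _ _ _ A B E W x us (nth 0 us)) => //.
  by exists w0; rewrite size_tuple.
have [u uS] := max_CIS_trajectory Cy.
rewrite (nominal_safe_halfspaces nu SE) in uS.
have bnd z : nominal_safe A E Sxu W nu z ->
    `|z| <= M0 + 1 + `|col_mx w0 (0 : 'cV[R]_m)|.
  move=> zS; rewrite -[z in leLHS](addrK (col_mx w0 0)).
  apply: le_trans (ler_normB _ _) _; rewrite lerD2r.
  apply: SM; first by rewrite ltrDl.
  by apply: zS; exists w0 => //; exists 0.
rewrite (nominal_safe_halfspaces nu SE) in bnd.
have [xb [ub []]] := trajectory_equilibrium bnd uS.
rewrite -(nominal_safe_halfspaces nu SE) => eqS eqE.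
exists (col_mx (xb + w0) ub).
apply: (maxl [set col_mx (xb + w) ub | w in disturbance_sum A E W nu]).
  split=> [_ [w Ww <-]|_ [w Ww <-] e We].
    rewrite companion_safeE mul1mx.
    have := eqS (col_mx w 0); rewrite add_col_mx addr0; apply.
    by exists w => //; exists 0.
  exists (A *m w + E *m e).
    rewrite -(disturbance_sum_stable E W nu0 A0 (leqnSn nu)).
    by apply/disturbance_sumS; exists w, e.
  by rewrite companion_step !mul1mx mulmxDr (addrAC _ (A *m w)) eqE addrA.
by exists w0.
Qed.

End Companion.

(** * The equivalence *)

Theorem theorem6p4 (R : realType) (n m d nu : nat)
    (A : 'M[R]_n) (B : 'M[R]_(n, m)) (E : 'M[R]_(n, d))
    (Sxu : set 'cV[R]_(n + m)) (W : set 'cV[R]_d)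
    (hA : nilpotency_index A nu) (hS : polytope Sxu) (hW : polytope W) :
  (C_outer A B E Sxu W nu !=set0 <->
     exists (q : nat) (P : 'M[R]_(m * q)) (H : 'M[R]_(m, m * q)),
       implicit_RCIS A B E Sxu W P H !=set0)
  /\
  (C_outer A B E Sxu W nu !=set0 <->
     implicit_RCIS A B E Sxu W (1%:M : 'M[R]_m) (1%:M : 'M[R]_m) !=set0).
Proof.
have [nu0 A0 _] := hA.
have const := @C_outer_implicit_RCIS _ _ _ _ A B E Sxu W nu nu0 A0 hS.
split; split=> [Cne|].
- (* With q = 1 the matrices have size m * 1, which is only provably m. *)
  exists 1%N; rewrite muln1; exists 1%:M, 1%:M; exact: const.
- by move=> [q [P [H]]]; exact: implicit_RCIS_C_outer.
- exact: const.
- exact: implicit_RCIS_C_outer.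
Qed.
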